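(* Let $\mathcal{V}$ be a semidegenerate congruence-modular variety and let $A\in\mathcal{V}$ be semiprime. If $\theta\in Con(A)$ then $Ann(\theta^{\ast})=(\theta^{\perp})^{\ast}$.
   Context: Algebras have a fixed finite signature $\tau$. A variety is semidegenerate if none of its nontrivial algebras has a one-element subalgebra. For $A$ in a semidegenerate congruence-modular variety $\mathcal{V}$, $Con(A)$ is the congruence lattice with least element $\Delta_A$ and greatest element $\nabla_A$; $K(A)$ is the set of compact (= finitely generated) congruences (here $\nabla_A\in K(A)$). $[\cdot,\cdot]$ is the modular commutator of Freese–McKenzie: the greatest operation on congruence lattices of members of $\mathcal{V}$ such that for every surjective morphism $f:A\to B$ and $\alpha,\beta\in Con(A)$, $[\alpha,\beta]_A\subseteq\alpha\cap\beta$ and $[\alpha,\beta]_A\lor Ker(f)=f^{-1}([f(\alpha\lor Ker(f)),f(\beta\lor Ker(f))]_B)$. It is commutative, monotone, distributes over arbitrary joins, and satisfies $[\theta,\nabla_A]=\theta$. The annihilator of $\alpha\in Con(A)$ is $\alpha^{\perp}=\bigvee\{\gamma\in Con(A)\mid[\alpha,\gamma]=\Delta_A\}$. A congruence $\phi\neq\nabla_A$ is prime if $[\alpha,\beta]\subseteq\phi$ implies $\alpha\subseteq\phi$ or $\beta\subseteq\phi$, for all $\alpha,\beta\in Con(A)$. $Spec(A)$ is the set of prime congruences. The radical is $\rho(\theta)=\bigwedge\{\phi\in Spec(A)\mid\theta\subseteq\phi\}$. $A$ is semiprime if $\rho(\Delta_A)=\Delta_A$. $C(A)$ is the smallest subset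 of $Con(A)$ containing $K(A)$ and closed under binary joins and commutators. For $\alpha,\beta\in C(A)$ put $\alpha\equiv\beta$ iff $\rho(\alpha)=\rho(\beta)$. $L(A)=C(A)/{\equiv}$ is a bounded distributive lattice with join induced by $\lor$, meet induced by $[\cdot,\cdot]$, $0$ = class of $\Delta_A$, $1$ = class of $\nabla_A$; $\lambda_A:C(A)\to L(A)$ is the quotient map. For $\theta\in Con(A)$, $\theta^{\ast}=\{\lambda_A(\alpha)\mid\alpha\in C(A),\alpha\subseteq\theta\}$ (an ideal of $L(A)$). For an ideal $I$ of a bounded distributive lattice $L$, $Ann(I)=\{x\in L\mid x\land y=0\text{ for all }y\in I\}$. *)

(* Defs.v *)
From HB Require Import structures.
From mathcomp Require Import all_boot all_order.
From mathcomp Require Import boolp classical_sets cardinality.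

Set Implicit Arguments.
Unset Strict Implicit.
Unset Printing Implicit Defensive.

Import Order.TTheory.
Local Open Scope classical_set_scope.
Local Open Scope order_scope.

Record signature := Signature { symbol : finType; arity : symbol -> nat }.

(* Algebras are nonempty. *)
Record algebra (tau : signature) := Algebra {
  carrier :> Type;
  interp : forall s : symbol tau, ('I_(arity s) -> carrier) -> carrier;
  carrier_inhabited : inhabited carrier }.
Arguments interp {tau} A s _ : rename.

Inductive term (tau : signature) : Type :=
| Var of nat
| App (s : symbol tau) of ('I_(arity s) -> term tau).

Fixpoint eval (tau : signature) (A : algebra tau) (v : nat -> A)
    (t : term tau) : A :=
  match t with
  | Var n => v n
  | App s ts => interp A s (fun i => eval v (ts i))
  end.

Definition satisfies (tau : signature) (A : algebra tau)
    (e : term tau * term tau) : Prop :=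
  forall v : nat -> A, eval v e.1 = eval v e.2.

Definition is_variety (tau : signature) (V : set (algebra tau)) : Prop :=
  exists E : set (term tau * term tau),
    V = [set A | forall e, E e -> satisfies A e].

Definition subuniverse (tau : signature) (A : algebra tau) (S : set A) : Prop :=
  forall (s : symbol tau) (x : 'I_(arity s) -> A),
    (forall i, S (x i)) -> S (interp A s x).

Definition semidegenerate (tau : signature) (V : set (algebra tau)) : Prop :=
  forall A : algebra tau, V A -> (exists x y : A, x <> y) ->
    ~ exists a : A, subuniverse [set a].

Record surj_morphism (tau : signature) (A B : algebra tau) := SurjMorphism {
  morph_fun :> A -> B;
  morph_interp : forall (s : symbol tau) (x : 'I_(arity s) -> A),
    morph_fun (interp A s x) = interp B s (morph_fun \o x);
  morph_surj : forall b : B, exists a : A, morph_fun a = b }.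

Section Congruences.
Variables (tau : signature) (A : algebra tau).
Implicit Types R : A -> A -> Prop.

Record is_congruence R : Prop := IsCongruence {
  congruence_refl : forall x, R x x;
  congruence_sym : forall x y, R x y -> R y x;
  congruence_trans : forall x y z, R x y -> R y z -> R x z;
  congruence_interp : forall (s : symbol tau) (x y : 'I_(arity s) -> A),
    (forall i, R (x i) (y i)) -> R (interp A s x) (interp A s y) }.

Record Con := MkCon { con_rel :> A -> A -> Prop; conP : is_congruence con_rel }.

Implicit Types alpha beta gamma theta : Con.

HB.instance Definition _ := gen_eqMixin Con.
HB.instance Definition _ := gen_choiceMixin Con.

Lemma con_ext alpha beta :
  (forall x y, alpha x y <-> beta x y) -> alpha = beta.
Proof.
case: alpha beta => [R RP] [S SP] /= RS.
have E : R = S by apply/funext => x; apply/funext => y; apply/propext.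
by case: S / E SP RS => SP _; congr MkCon; apply: Prop_irrelevance.
Qed.

Definition con_le alpha beta : bool := `[< forall x y, alpha x y -> beta x y >].

Fact con_le_refl : reflexive con_le.
Proof. by move=> a; apply/asboolP. Qed.

Fact con_le_anti : antisymmetric con_le.
Proof.
move=> a b /andP[/asboolP ab /asboolP ba].
by apply: con_ext => x y; split; [apply: ab | apply: ba].
Qed.

Fact con_le_trans : transitive con_le.
Proof.
move=> b a c /asboolP ab /asboolP bc.
by apply/asboolP => x y /ab /bc.
Qed.

Fact con_display : Order.disp_t. Proof. exact: Order.Disp tt tt. Qed.

HB.instance Definition _ :=
  Order.Le_isPOrder.Build con_display Con con_le_refl con_le_anti con_le_trans.

Lemma con_leP alpha beta :
  reflect (forall x y, alpha x y -> beta x y) (alpha <= beta).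
Proof. exact: asboolP. Qed.

Lemma con_leW alpha beta x y : alpha <= beta -> alpha x y -> beta x y.
Proof. by move/con_leP; apply. Qed.

(* The infimum of a set of congruences; the total relation if S is empty. *)
Fact con_inf_subproof (S : set Con) :
  is_congruence (fun x y => forall theta, S theta -> theta x y).
Proof.
split=> [x t St|x y h t St|x y z h1 h2 t St|s x y h t St].
- exact: congruence_refl (conP t) _.
- by apply: (congruence_sym (conP t)); apply: h.
- by apply: (congruence_trans (conP t)); [apply: h1 | apply: h2].
- by apply: (congruence_interp (conP t)) => i; apply: h.
Qed.
Definition con_inf (S : set Con) : Con := MkCon (con_inf_subproof S).

Definition con_gen (X : set (A * A)) : Con :=
  con_inf [set theta : Con | forall p, X p -> theta p.1 p.2].

Definition con_sup (S : set Con) : Con :=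
  con_gen [set p | exists2 theta, S theta & theta p.1 p.2].

Fact con_diag_subproof : is_congruence (fun x y : A => x = y).
Proof.
split=> [//|//|x y z -> //|s x y h].
by congr interp; apply/funext => i; apply: h.
Qed.
Definition con_diag : Con := MkCon con_diag_subproof.

Fact con_total_subproof : is_congruence (fun _ _ : A => True).
Proof. by split. Qed.
Definition con_total : Con := MkCon con_total_subproof.

Definition con_meet alpha beta : Con :=
  con_inf [set theta | theta = alpha \/ theta = beta].

Definition con_join alpha beta : Con :=
  con_sup [set theta | theta = alpha \/ theta = beta].

Lemma con_gen_le (X : set (A * A)) theta :
  con_gen X <= theta <-> (forall p, X p -> theta p.1 p.2).
Proof.
split=> [/con_leP h p Xp|h]; first by apply: h => t; apply.
by apply/con_leP => x y; apply.
Qed.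

Lemma con_sup_le (S : set Con) theta :
  con_sup S <= theta <-> (forall alpha, S alpha -> alpha <= theta).
Proof.
rewrite con_gen_le; split=> [h a Sa|h [x y] [a Sa axy]].
  by apply/con_leP => x y axy; apply: (h (x, y)); exists a.
exact/(con_leP _ _ (h _ Sa)).
Qed.

Lemma le_con_inf (S : set Con) theta :
  theta <= con_inf S <-> (forall alpha, S alpha -> theta <= alpha).
Proof.
split=> [/con_leP h a Sa|h]; first by apply/con_leP => x y /h; apply.
by apply/con_leP => x y txy a Sa; apply/(con_leP _ _ (h _ Sa)).
Qed.

Fact con_meetP alpha beta gamma :
  (alpha <= con_meet beta gamma) = (alpha <= beta) && (alpha <= gamma).
Proof.
apply/idP/andP => [/le_con_inf h|[ab ac]].
  by split; apply: h; [left | right].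
by apply/le_con_inf => t [->|->].
Qed.

Fact con_joinP alpha beta gamma :
  (con_join alpha beta <= gamma) = (alpha <= gamma) && (beta <= gamma).
Proof.
apply/idP/andP => [/con_sup_le h|[ab ac]].
  by split; apply: h; [left | right].
by apply/con_sup_le => t [->|->].
Qed.

HB.instance Definition _ :=
  Order.POrder_MeetJoin_isLattice.Build con_display Con con_meetP con_joinP.

Fact con_diag_le alpha : con_diag <= alpha.
Proof. by apply/con_leP => x _ <-; apply: congruence_refl (conP alpha) _. Qed.

Fact con_le_total alpha : alpha <= con_total.
Proof. exact/con_leP. Qed.

HB.instance Definition _ := Order.hasBottom.Build con_display Con con_diag_le.
HB.instance Definition _ := Order.hasTop.Build con_display Con con_le_total.

Definition compact_con theta : Prop :=
  exists2 X : set (A * A), finite_set X & theta = con_gen X.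

End Congruences.

Definition congruence_modular (tau : signature) (V : set (algebra tau)) : Prop :=
  forall A : algebra tau, V A -> forall alpha beta gamma : Con A,
    alpha <= gamma -> (alpha `|` beta) `&` gamma = alpha `|` (beta `&` gamma).

Section Morphisms.
Variables (tau : signature) (A B : algebra tau) (f : surj_morphism A B).

Fact preimage_con_subproof (theta : Con B) :
  is_congruence (fun x y : A => theta (f x) (f y)).
Proof.
case: (conP theta) => r s t i; split=> [x|x y|x y z|o x y h].
- exact: r.
- exact: s.
- exact: t.
- by rewrite !morph_interp; apply: i.
Qed.
Definition preimage_con (theta : Con B) : Con A :=
  MkCon (preimage_con_subproof theta).

Definition Ker : Con A := preimage_con \bot.

(* f(alpha \/ Ker f): under a surjective morphism f, the set-theoretic image of
   a congruence containing Ker f is a congruence. *)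
Fact image_con_subproof (alpha : Con A) :
  is_congruence (fun u v : B =>
    exists x y : A, [/\ (alpha `|` Ker) x y, f x = u & f y = v]).
Proof.
set g := alpha `|` Ker; case: (conP g) => r s t i.
have kg x y : f x = f y -> g x y.
  by move=> fxy; apply: (con_leW (leUr Ker alpha)).
split=> [u|u v [x [y [xy <- <-]]]|u v w|o u v h].
- by have [x <-] := morph_surj f u; exists x, x.
- by exists y, x; split=> //; apply: s.
- move=> [x [y [xy <- <-]]] [y' [z [yz /esym fyy' <-]]]; exists x, z; split=> //.
  by apply: (t _ _ _ xy); apply: t yz; apply: kg.
- have [x xP] := choice h; have [y yP] := choice xP.
  exists (interp A o x), (interp A o y); split.
  + by apply: i => j; have [] := yP j.
  + by rewrite morph_interp; congr interp; apply/funext => j /=; have [] := yP j.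
  + by rewrite morph_interp; congr interp; apply/funext => j /=; have [] := yP j.
Qed.
Definition image_join_ker (alpha : Con A) : Con B :=
  MkCon (image_con_subproof alpha).

End Morphisms.

Record member (tau : signature) (V : set (algebra tau)) := Member {
  member_alg :> algebra tau; memberP : V member_alg }.

Section Commutator.
Variables (tau : signature) (V : set (algebra tau)).

Definition con_operation := forall A : member V, Con A -> Con A -> Con A.

Definition commutator_operation (C : con_operation) : Prop :=
  forall (A B : member V) (f : surj_morphism A B) (alpha beta : Con A),
    C A alpha beta <= alpha `&` beta /\
    C A alpha beta `|` Ker f =
      preimage_con f (C B (image_join_ker f alpha) (image_join_ker f beta)).

(* The pointwise join of all commutator operations, which is itself one, hence
   the greatest: commutator_greatest. *)
Definition commutator : con_operation := fun A alpha beta =>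
  con_sup [set gamma | exists2 C : con_operation,
                         commutator_operation C & gamma = C A alpha beta].

End Commutator.
Notation "[ 'comm' alpha , beta ]" := (commutator alpha beta)
  (at level 0, alpha at level 99, beta at level 99, format "[ 'comm'  alpha ,  beta ]").

Section CommutatorTheory.
Variables (tau : signature) (V : set (algebra tau)).

Lemma commutator_le_meet (A : member V) (alpha beta : Con A) :
  [comm alpha, beta] <= alpha `&` beta.
Proof.
apply/con_sup_le => g [C CP ->].
have idA : surj_morphism A A.
  by exists idfun => // b; exists b.
by have [] := CP _ _ idA alpha beta.
Qed.

Lemma preimage_con_le (A B : algebra tau) (f : surj_morphism A B)
  (alpha beta : Con B) :
  (preimage_con f alpha <= preimage_con f beta) = (alpha <= beta).
Proof.
apply/con_leP/con_leP => h u v; last exact: h.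
have [x <-] := morph_surj f u; have [y <-] := morph_surj f v; exact: h.
Qed.

Lemma preimage_image (A B : algebra tau) (f : surj_morphism A B)
  (alpha : Con A) : preimage_con f (image_join_ker f alpha) = alpha `|` Ker f.
Proof.
have [r s t i] := conP (alpha `|` Ker f).
have kg x y : f x = f y -> (alpha `|` Ker f) x y.
  by move=> fxy; apply: (con_leW (leUr (Ker f) alpha)).
apply: con_ext => x y; split=> [[x' [y' [h /esym/kg xx' /kg yy']]]|h].
  by apply: (t _ _ _ xx'); apply: t yy'; exact: h.
by exists x, y.
Qed.

Lemma commutator_greatest :
  commutator_operation (@commutator tau V) /\
  forall C : con_operation V, commutator_operation C ->
    forall (A : member V) (alpha beta : Con A),
      C A alpha beta <= [comm alpha, beta].
Proof.
have ub (C : con_operation V) (CP : commutator_operation C)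
    (A : member V) (a b : Con A) : C A a b <= [comm a, b].
  have /con_sup_le h := lexx [comm a, b].
  by apply: h; exists C.
split=> // A B f a b; split; first exact: commutator_le_meet.
set fa := image_join_ker f a; set fb := image_join_ker f b.
have kp (t : Con B) : Ker f <= preimage_con f t by rewrite preimage_con_le le0x.
apply/eqP; rewrite eq_le; apply/andP; split.
  rewrite leUx kp andbT; apply/con_sup_le => g [C CP ->].
  have [_ CE] := CP _ _ f a b.
  by rewrite (le_trans (leUl _ (Ker f)))// CE preimage_con_le; apply: ub.
suff h : [comm fa, fb] <= image_join_ker f [comm a, b].
  by rewrite -preimage_image preimage_con_le.
apply/con_sup_le => g [C CP ->]; have [_ CE] := CP _ _ f a b.
by rewrite -(preimage_con_le f) preimage_image -CE leU2// ub.
Qed.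

End CommutatorTheory.

Section Spectrum.
Variables (tau : signature) (V : set (algebra tau)) (A : member V).
Implicit Types alpha beta gamma theta phi : Con A.

Definition perp alpha : Con A :=
  con_sup [set gamma | [comm alpha, gamma] = \bot].

Definition prime_con phi : Prop :=
  phi <> \top /\
  forall alpha beta, [comm alpha, beta] <= phi -> alpha <= phi \/ beta <= phi.

Definition Spec : set (Con A) := [set phi | prime_con phi].

Definition radical theta : Con A :=
  con_inf [set phi | Spec phi /\ theta <= phi].

Definition semiprime : Prop := radical \bot = \bot.

Inductive in_C : Con A -> Prop :=
| in_C_compact theta of compact_con theta : in_C theta
| in_C_join alpha beta of in_C alpha & in_C beta : in_C (alpha `|` beta)
| in_C_comm alpha beta of in_C alpha & in_C beta : in_C [comm alpha, beta].

Definition C : Type := {theta : Con A | `[< in_C theta >]}.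
HB.instance Definition _ := Choice.on C.

Definition C_equiv : rel C :=
  fun a b => radical (val a) == radical (val b).

Fact C_equiv_refl : reflexive C_equiv.
Proof. by move=> a; apply: eqxx. Qed.
Fact C_equiv_sym : symmetric C_equiv.
Proof. by move=> a b; apply: eq_sym. Qed.
Fact C_equiv_trans : transitive C_equiv.
Proof. by move=> b a c /eqP ab /eqP bc; apply/eqP; rewrite ab. Qed.

Canonical C_equiv_rel := EquivRel C_equiv C_equiv_refl C_equiv_sym C_equiv_trans.

Lemma radical_eqP alpha beta :
  radical alpha = radical beta <->
  (forall phi, Spec phi -> (alpha <= phi) = (beta <= phi)).
Proof.
have le_rad (t : Con A) : t <= radical t.
  by apply/le_con_inf => p [].
have rad_le (t p : Con A) : Spec p -> (radical t <= p) = (t <= p).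
  move=> pP; apply/idP/idP => [|tp]; first exact: le_trans.
  have /le_con_inf h := lexx (radical t).
  by apply: h.
split=> [ab p pP|ab]; first by rewrite -(rad_le alpha)// ab rad_le.
by congr con_inf; apply/funext => p; apply/propext; split=> -[pP];
   [rewrite ab | rewrite -ab].
Qed.

Lemma prime_comm phi alpha beta : Spec phi ->
  ([comm alpha, beta] <= phi) = (alpha <= phi) || (beta <= phi).
Proof.
move=> [_ pP]; apply/idP/orP => [/pP//|h].
apply: le_trans (commutator_le_meet alpha beta) _.
by rewrite leIx2//; case: h => ->; rewrite ?orbT.
Qed.

End Spectrum.
Arguments Spec {tau V} A _.
Arguments semiprime {tau V} A.
Arguments C {tau V} A.

Record sdcm_variety (tau : signature) := SdcmVariety {
  sdcm_class :> set (algebra tau);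
  sdcm_is_variety : is_variety sdcm_class;
  sdcm_semidegenerate : semidegenerate sdcm_class;
  sdcm_modular : congruence_modular sdcm_class }.

Section Quotient.
Variables (tau : signature) (A : algebra tau) (theta : Con A).

Definition quotient_carrier := {X : A -> Prop | exists a, X = theta a}.

Definition quotient_class (a : A) : quotient_carrier :=
  exist _ (con_rel theta a) (ex_intro _ a erefl).

Definition quotient_repr (X : quotient_carrier) : A := sval (cid (svalP X)).

Lemma quotient_reprK X : quotient_class (quotient_repr X) = X.
Proof.
case: X => X XP; rewrite /quotient_repr; case: cid => a /= Xa; exact: eq_exist.
Qed.

Lemma quotient_classP a b : quotient_class a = quotient_class b <-> theta a b.
Proof.
have [r s t _] := conP theta; split=> [[ab]|ab].
  by rewrite ab; apply: r.
apply: eq_exist; apply/funext => x; apply/propext; split=> h.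
  by apply: t h; apply: s.
by apply: t h.
Qed.

Definition quotient_algebra : algebra tau :=
  @Algebra tau quotient_carrier
    (fun s x => quotient_class (interp A s (quotient_repr \o x)))
    (let: inhabits a := carrier_inhabited A in inhabits (quotient_class a)).

Lemma quotient_interp (s : symbol tau) (x : 'I_(arity s) -> A) :
  quotient_class (interp A s x) =
  interp quotient_algebra s (quotient_class \o x).
Proof.
apply/quotient_classP; apply: (congruence_interp (conP theta)) => i /=.
by apply/quotient_classP; rewrite quotient_reprK.
Qed.

Lemma quotient_satisfies e : satisfies A e -> satisfies quotient_algebra e.
Proof.
move=> Ae v; pose u n := quotient_repr (v n).
have E t : eval v t = quotient_class (eval u t).
  elim: t => [n|s ts IH]; first by rewrite /= quotient_reprK.
  have vts : (fun i => eval v (ts i)) = quotient_class \o (fun i => eval u (ts i)).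
    by apply/funext => i; apply: IH.
  exact: etrans (congr1 (interp quotient_algebra s) vts) (esym (quotient_interp _)).
by rewrite !E Ae.
Qed.

End Quotient.

(* nabla_A is finitely generated because tau is finite and V semidegenerate: if
   it is generated by the pairs (a, s(a,...,a)), s in tau, no nontrivial
   quotient of A by them can have {a} as a subalgebra. *)
Lemma total_compact (tau : signature) (V : sdcm_variety tau) (A : member V) :
  compact_con (\top : Con A).
Proof.
case: (carrier_inhabited A) => a.
pose X : set (A * A) := range (fun s : symbol tau => (a, interp A s (fun=> a))).
exists X; first exact: finite_image.
set t := con_gen X; apply: contrapT => tT.
have [E VE] := sdcm_is_variety V.
have VP B : sdcm_class V B <-> (forall e, E e -> satisfies B e) by rewrite VE.
have VQ : sdcm_class V (quotient_algebra t).
  apply/VP => e Ee; apply: quotient_satisfies.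
  by move: e Ee; apply/VP; apply: memberP.
apply: (sdcm_semidegenerate VQ).
  apply: contrapT => h; apply: tT; apply: con_ext => x y; split=> // _.
  apply/quotient_classP; apply: contrapT => xy; apply: h.
  by exists (quotient_class t x), (quotient_class t y).
exists (quotient_class t a) => s x xa.
have -> : x = quotient_class t \o (fun=> a) by apply/funext => i; apply: xa.
rewrite -quotient_interp; apply/esym/quotient_classP.
have /con_gen_le h := lexx t.
by apply: (h (a, _)); exists s.
Qed.

Section Reticulation.
Variables (tau : signature) (V : sdcm_variety tau) (A : member V).
Implicit Types alpha beta : C A.

Definition L := {eq_quot (@C_equiv_rel tau V A)}%qT.
HB.instance Definition _ := Choice.on L.

Definition lambda (alpha : C A) : L := (\pi_L alpha)%qT.

Lemma lambdaP alpha beta :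
  lambda alpha = lambda beta <-> radical (val alpha) = radical (val beta).
Proof.
split=> [/eqmodP/eqP //|h]; apply/eqmodP; exact/eqP.
Qed.

Definition C_join alpha beta : C A :=
  exist _ (val alpha `|` val beta)
    (asboolT (in_C_join (asboolW (valP alpha)) (asboolW (valP beta)))).
Definition C_comm alpha beta : C A :=
  exist _ [comm val alpha, val beta]
    (asboolT (in_C_comm (asboolW (valP alpha)) (asboolW (valP beta)))).

Fact bot_compact : compact_con (\bot : Con A).
Proof.
exists set0 => //; apply/eqP; rewrite eq_le le0x /=.
by apply/con_gen_le.
Qed.
Definition C_bot : C A := exist _ \bot (asboolT (in_C_compact bot_compact)).
Definition C_top : C A :=
  exist _ \top (asboolT (in_C_compact (total_compact A))).

Definition L_join (x y : L) : L := lambda (C_join (repr x) (repr y)).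
Definition L_meet (x y : L) : L := lambda (C_comm (repr x) (repr y)).

Lemma lambda_eqP alpha beta :
  lambda alpha = lambda beta <->
  (forall phi, Spec A phi -> (val alpha <= phi) = (val beta <= phi)).
Proof. by rewrite lambdaP radical_eqP. Qed.

Lemma L_ind (P : L -> Prop) : (forall alpha, P (lambda alpha)) -> forall x, P x.
Proof. by move=> h x; rewrite -[x]reprK; apply: h. Qed.

Lemma lambda_repr alpha phi : Spec A phi ->
  (val (repr (lambda alpha)) <= phi) = (val alpha <= phi).
Proof. by move=> pP; apply: (iffLR (lambda_eqP _ _)) => //; exact: reprK. Qed.

Lemma L_joinE alpha beta :
  L_join (lambda alpha) (lambda beta) = lambda (C_join alpha beta).
Proof. by apply/lambda_eqP => p pP; rewrite !leUx !lambda_repr. Qed.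

Lemma L_meetE alpha beta :
  L_meet (lambda alpha) (lambda beta) = lambda (C_comm alpha beta).
Proof. by apply/lambda_eqP => p pP; rewrite !prime_comm ?lambda_repr. Qed.

Let LE := (L_joinE, L_meetE).
Let primeE p (pP : Spec A p) := (@leUx _ (Con A), fun a b => @prime_comm _ _ A p a b pP).

Fact L_meetC : commutative L_meet.
Proof.
elim/L_ind => a; elim/L_ind => b; rewrite !LE; apply/lambda_eqP => p pP /=.
by rewrite !(primeE pP) orbC.
Qed.
Fact L_joinC : commutative L_join.
Proof.
elim/L_ind => a; elim/L_ind => b; rewrite !LE; apply/lambda_eqP => p pP /=.
by rewrite !(primeE pP) andbC.
Qed.
Fact L_meetA : associative L_meet.
Proof.
elim/L_ind => a; elim/L_ind => b; elim/L_ind => c; rewrite !LE.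
by apply/lambda_eqP => p pP /=; rewrite !(primeE pP) orbA.
Qed.
Fact L_joinA : associative L_join.
Proof.
elim/L_ind => a; elim/L_ind => b; elim/L_ind => c; rewrite !LE.
by apply/lambda_eqP => p pP /=; rewrite !(primeE pP) andbA.
Qed.
Fact L_joinKI y x : L_meet x (L_join x y) = x.
Proof.
elim/L_ind: x => a; elim/L_ind: y => b; rewrite !LE; apply/lambda_eqP => p pP /=.
by rewrite !(primeE pP); case: (_ <= _).
Qed.
Fact L_meetKU y x : L_join x (L_meet x y) = x.
Proof.
elim/L_ind: x => a; elim/L_ind: y => b; rewrite !LE; apply/lambda_eqP => p pP /=.
by rewrite !(primeE pP); case: (_ <= _).
Qed.
Fact L_meetUl : left_distributive L_meet L_join.
Proof.
elim/L_ind => a; elim/L_ind => b; elim/L_ind => c; rewrite !LE.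
by apply/lambda_eqP => p pP /=; rewrite !(primeE pP) orb_andl.
Qed.
Fact L_meetxx : idempotent_op L_meet.
Proof.
elim/L_ind => a; rewrite !LE; apply/lambda_eqP => p pP /=.
by rewrite !(primeE pP) orbb.
Qed.

Fact L_display : Order.disp_t. Proof. exact: Order.Disp tt tt. Qed.

HB.instance Definition _ :=
  @Order.isMeetJoinDistrLattice.Build L_display L
    (fun x y => L_meet x y == x) (fun x y => (y != x) && (L_meet x y == x))
    L_meet L_join (fun _ _ => erefl) (fun _ _ => erefl)
    L_meetC L_joinC L_meetA L_joinA L_joinKI L_meetKU L_meetUl L_meetxx.

Fact L_bot_le (x : L) : lambda C_bot <= x.
Proof.
elim/L_ind: x => a; apply/eqP; rewrite LE; apply/lambda_eqP => p pP /=.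
by rewrite (primeE pP) !le0x.
Qed.
Fact L_le_top (x : L) : x <= lambda C_top.
Proof.
elim/L_ind: x => a; apply/eqP; rewrite LE; apply/lambda_eqP => p pP /=.
by rewrite (primeE pP) [\top <= p]le1x; case: pP => /eqP/negbTE ->; rewrite orbF.
Qed.

HB.instance Definition _ := Order.hasBottom.Build L_display L L_bot_le.
HB.instance Definition _ := Order.hasTop.Build L_display L L_le_top.

Definition star (theta : Con A) : set L :=
  [set x | exists2 alpha : C A, val alpha <= theta & x = lambda alpha].

End Reticulation.

Definition is_ideal d (T : tbDistrLatticeType d) (I : set T) : Prop :=
  [/\ I \bot, forall x y, x <= y -> I y -> I x &
      forall x y, I x -> I y -> I (x `|` y)].

Lemma star_ideal (tau : signature) (V : sdcm_variety tau) (A : member V)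
  (theta : Con A) : is_ideal (star theta).
Proof.
split.
- by exists (C_bot A); rewrite //= le0x.
- elim/L_ind => b y byy [a at_ E]; move: byy; rewrite {y}E => /eqP.
  rewrite L_meetE => <-; exists (C_comm b a) => //=.
  by apply: le_trans (commutator_le_meet _ _) _; rewrite leIx2// at_ orbT.
- move=> _ _ [a at_ ->] [b bt ->]; exists (C_join a b); first by rewrite leUx at_.
  exact: L_joinE.
Qed.

(* Used for ideals only; the formula makes sense for every subset. *)
Definition Ann d (T : tbDistrLatticeType d) (I : set T) : set T :=
  [set x | forall y, I y -> x `&` y = \bot].

(* Main.v *)
Require Import Defs.
From mathcomp Require Import all_boot all_order.
From mathcomp Require Import boolp classical_sets.

(* Whether a prime phi contains [alpha, theta] depends only on whether it
   contains alpha or theta.  A prime omitting theta contains perp theta, which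
   gives one inclusion.  Conversely, if lambda alpha annihilates star theta,
   then a prime omitting alpha contains every principal congruence below theta,
   hence theta; so [alpha, theta] lies in all primes, and semiprimeness makes it
   trivial. *)

Import Order.TTheory.
Local Open Scope classical_set_scope.
Local Open Scope order_scope.

Section Annihilators.
Variables (tau : signature) (V : sdcm_variety tau) (A : member V).
Implicit Types (theta phi : Con A) (alpha beta : C A).

Lemma perp_le_prime theta phi :
  Spec A phi -> ~~ (theta <= phi) -> perp theta <= phi.
Proof.
move=> phiP /negbTE thphi; apply/con_sup_le => gamma /= thgamma.
by move: (prime_comm theta gamma phiP); rewrite thgamma le0x thphi.
Qed.

(** The commutator induces the meet of [L], and a class is [\bot] exactly when its representatives
    lie in every prime. *)
Lemma lambda_meet_eq0 alpha beta :
  lambda alpha `&` lambda beta = \bot <->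
  forall phi, Spec A phi -> (val alpha <= phi) || (val beta <= phi).
Proof.
have -> : lambda alpha `&` lambda beta = lambda (C_comm alpha beta).
  exact: L_meetE.
split=> [/lambda_eqP h phi phiP|h].
  by rewrite -prime_comm//; move: (h _ phiP) => /= ->; rewrite le0x.
by apply/lambda_eqP => phi phiP /=; rewrite prime_comm// h// le0x.
Qed.

(** Each pair in [theta] generates a compact congruence below [theta], which is therefore a member
    of [C A]. *)
Lemma le_of_le_C theta phi :
  (forall beta, val beta <= theta -> val beta <= phi) -> theta <= phi.
Proof.
move=> h; apply/con_leP => x y thxy.
have gP : compact_con (con_gen [set (x, y)] : Con A).
  by exists [set (x, y)].
pose beta : C A :=
  exist (fun t : Con A => `[< in_C t >]) _ (asboolT (in_C_compact gP)).
have /h /con_gen_le : val beta <= theta by apply/con_gen_le => _ ->.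
by move/(_ (x, y) erefl).
Qed.

End Annihilators.

Theorem proposition4p7 (tau : signature) (V : sdcm_variety tau) (A : member V)
  (hA : semiprime A) (theta : Con A) :
  Ann (star theta) = star (perp theta).
Proof.
apply/seteqP; split.
- elim/L_ind => alpha annP; exists alpha => //.
  (* As a join, [perp theta] lies above each of its joinands, so it suffices that [val alpha] is one
     of them. *)
  have /con_sup_le : perp theta <= perp theta by [].
  apply; apply/eqP; rewrite /= -lex0 -hA; apply/le_con_inf => phi [phiP _].
  rewrite prime_comm// orbC; case: (boolP (val alpha <= phi)) => //= alphi.
  apply: le_of_le_C => beta betath.
  have /lambda_meet_eq0 /(_ _ phiP) : lambda alpha `&` lambda beta = \bot.
    by apply: annP; exists beta.
  by rewrite (negbTE alphi).
- move=> _ [alpha alperp ->] _ [beta betath ->].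
  apply/lambda_meet_eq0 => phi phiP; rewrite orbC.
  case: (boolP (theta <= phi)) => [/(le_trans betath) -> //|thphi].
  by rewrite (le_trans alperp (perp_le_prime _ _ _ _ _ phiP thphi)) orbT.
Qed.
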